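(* Let $\mu>0$ and let $h$ be an intensity function. If $\lim_{x\to\infty}h(x)=c$ for some real $c>0$, then $$\lim_{x_e\to\infty}PoA(h,x_e)=2 .$$
   Context: Fix $\mu>0$ (service rate) and $c_t>0$ (travel cost per unit distance). An intensity function is a nonnegative measurable function $h$ on $[0,\infty)$ such that $\lambda(x)=\int_0^x h(y)\,dy$ is finite for all $x\ge 0$. In the M/G/1/1 loss system, customers with distance less than $x$ from the server arrive as a Poisson process of rate $\lambda(x)$; a customer joins only if the server is idle and his distance is at most the threshold in use. The service value is $R$, the waiting cost per unit time is $c_w$, and $x_e=\frac{R\mu-c_w}{c_t\mu}>0$ is the Nash equilibrium threshold (treated as a positive parameter, with $\mu$ and $h$ fixed). The expected social benefit per unit time with threshold $x\ge 0$ is $$S(x)=\frac{c_t\int_0^x (x_e-y)h(y)\,dy}{1+\frac1\mu\int_0^x h(y)\,dy}.$$ The socially optimal threshold $x^*$ (which maximizes $S$ over $x\ge0$) is the unique $x\ge 0$ satisfying $x_e=\frac1\mu\int_0^{x}(x-y)h(y)\,dy+x$; it depends on $x_e$, $h$ and $\mu$. The price of anarchy is $$PoA(h,x_e)=\frac{S(x^* )}{S(x_e)}=\frac{\int_{0}^{x^*} (x_e-y)h(y)\,dy}{\int_{0}^{x_e} (x_e-y)h(y)\,dy}\cdot\frac{1+\frac{1}{\mu} \int_{0}^{x_e} h(y)\,dy}{1+\frac{1}{\mu} \int_{0}^{x^*} h(y)\,dy}$$ (defined whenever $\int_0^{x_e}h(y)\,dy>0$; $c_t$ cancels). *)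

(* Defs.v *)
From mathcomp Require Import all_boot all_order all_algebra.
From mathcomp Require Import all_classical all_reals all_analysis.
From mathcomp Require Import measurable_realfun.
From mathcomp Require Import ring lra.
Set Implicit Arguments.
Unset Strict Implicit.
Unset Printing Implicit Defensive.
Import Order.TTheory GRing.Theory Num.Theory.
Import numFieldNormedType.Exports.
Local Open Scope classical_set_scope.
Local Open Scope ring_scope.

(* Throughout, [mu] is the service rate (not a measure), [ct] the travel cost
   per unit distance, [h] the intensity function and [xe] the Nash equilibrium
   threshold. Only the values of [h] on [0, +oo[ matter. *)

Definition is_intensity (R : realType) (h : R -> R) : Prop :=
  [/\ measurable_fun (`[0, +oo[ : set R) h,
      (forall x : R, 0 <= x -> 0 <= h x)
    & (forall x : R, 0 <= x ->
        (\int[lebesgue_measure]_(y in `[0%R, x]) (h y)%:E < +oo)%E)].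

Definition arrival_rate (R : realType) (h : R -> R) (x : R) : R :=
  \int[lebesgue_measure]_(y in `[0, x]) h y.

Definition social_benefit (R : realType) (mu ct : R) (h : R -> R)
    (xe x : R) : R :=
  ct * (\int[lebesgue_measure]_(y in `[0, x]) ((xe - y) * h y))
  / (1 + mu^-1 * arrival_rate h x).

Definition optimality_equation (R : realType) (mu : R) (h : R -> R)
    (xe x : R) : Prop :=
  xe = mu^-1 * (\int[lebesgue_measure]_(y in `[0, x]) ((x - y) * h y)) + x.

(* Definite description; [optimal_thresholdP] and [optimal_threshold_unique]
   show that it is proper, and [optimal_threshold_max] that it maximizes the
   social benefit. *)
Definition optimal_threshold (R : realType) (mu : R) (h : R -> R)
    (xe : R) : R :=
  get [set x : R | 0 <= x /\ optimality_equation mu h xe x].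

(* Equals [0], by the convention [x / 0 = 0], when there are no arrivals up to
   [xe]; [ct] cancels out, see [PoAE]. *)
Definition PoA (R : realType) (mu ct : R) (h : R -> R) (xe : R) : R :=
  social_benefit mu ct h xe (optimal_threshold mu h xe)
  / social_benefit mu ct h xe xe.

Lemma PoAE (R : realType) (mu ct : R) (h : R -> R) (xe : R) : 0 < ct ->
  let xs := optimal_threshold mu h xe in
  PoA mu ct h xe =
  (\int[lebesgue_measure]_(y in `[0, xs]) ((xe - y) * h y))
  / (\int[lebesgue_measure]_(y in `[0, xe]) ((xe - y) * h y))
  * ((1 + mu^-1 * \int[lebesgue_measure]_(y in `[0, xe]) h y)
     / (1 + mu^-1 * \int[lebesgue_measure]_(y in `[0, xs]) h y)).
Proof.
move=> ct0 xs; rewrite /PoA /social_benefit /arrival_rate -/xs.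
have key (a b d e : R) : ct * a / d / (ct * b / e) = a / b * (e / d).
  transitivity (ct / ct * (a / b * (e / d))); first by rewrite !invfM invrK; ring.
  by rewrite divff ?mul1r// lt0r_neq0.
exact: key.
Qed.

Lemma intensity_integrable (R : realType) (h : R -> R) (x : R) :
  is_intensity h -> 0 <= x ->
  lebesgue_measure.-integrable `[0, x] (EFin \o h).
Proof.
case=> mh h0 hoo x0.
have sub : `[0, x] `<=` `[0, +oo[.
  by move=> y /=; rewrite !in_itv/= => /andP[->].
apply/integrableP; split.
  by apply/measurable_EFinP; apply: measurable_funS mh.
apply: le_lt_trans (hoo x x0); rewrite le_eqVlt; apply/orP; left; apply/eqP.
apply: eq_integral => y; rewrite inE/= in_itv/= => /andP[y0 _].
by rewrite ger0_norm ?h0.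
Qed.

Lemma moment_integrable (R : realType) (h : R -> R) (a x : R) :
  is_intensity h -> 0 <= x ->
  lebesgue_measure.-integrable `[0, x] (EFin \o (fun y => (a - y) * h y)).
Proof.
move=> ih x0; have ihx := intensity_integrable ih x0.
have mI : measurable (`[0, x] : set (measurableTypeR R)) by exact: measurable_itv.
have := integrableZl mI (`|a| + x) ihx.
apply: le_integrable => //.
  apply/measurable_EFinP; apply: measurable_funM.
    exact: measurable_funB.
  by have /measurable_int/measurable_EFinP := ihx.
move=> y /=; rewrite in_itv/= => /andP[y0 yx].
rewrite lee_fin !normrM ler_wpM2r//.
rewrite (@ger0_norm _ (`|a| + x)) ?addr_ge0//.
by rewrite (le_trans (ler_normB _ _))// lerD2l ger0_norm.
Qed.

Lemma Rintegral_moment (R : realType) (h : R -> R) (a b x : R) :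
  is_intensity h -> 0 <= x ->
  \int[lebesgue_measure]_(y in `[0, x]) ((a - y) * h y) =
  (a - b) * arrival_rate h x +
  \int[lebesgue_measure]_(y in `[0, x]) ((b - y) * h y).
Proof.
move=> ih x0; have ihx := intensity_integrable ih x0.
have mI : measurable (`[0, x] : set (measurableTypeR R)) by exact: measurable_itv.
rewrite /arrival_rate -RintegralZl// -RintegralD//; last 2 first.
- exact: (integrableZl mI (a - b) ihx).
- exact: moment_integrable.
by apply: eq_Rintegral => y _; ring.
Qed.

Lemma arrival_rate_ge0 (R : realType) (h : R -> R) (x : R) :
  is_intensity h -> 0 <= arrival_rate h x.
Proof.
case=> _ h0 _; apply: Rintegral_ge0 => y /=.
by rewrite in_itv/= => /andP[/h0].
Qed.

Lemma Rintegral_moment_split (R : realType) (h : R -> R) (a x z : R) :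
  is_intensity h -> 0 <= x -> x <= z ->
  \int[lebesgue_measure]_(y in `[0, z]) ((a - y) * h y) =
  \int[lebesgue_measure]_(y in `[0, x]) ((a - y) * h y) +
  \int[lebesgue_measure]_(y in `]x, z]) ((a - y) * h y).
Proof.
move=> ih x0 xz.
rewrite -(@Rintegral_itvB _ _ (BLeft 0) (BRight z) x) ?bnd_simp//; first ring.
exact: moment_integrable (le_trans x0 xz).
Qed.

(* The partial first moment is largest when cut at its centre. *)
Lemma Rintegral_moment_max (R : realType) (h : R -> R) (a x : R) :
  is_intensity h -> 0 <= a -> 0 <= x ->
  \int[lebesgue_measure]_(y in `[0, x]) ((a - y) * h y) <=
  \int[lebesgue_measure]_(y in `[0, a]) ((a - y) * h y).
Proof.
move=> ih a0 x0; have [_ h0 _] := ih.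
have [xa|/ltW ax] := leP x a.
  rewrite (Rintegral_moment_split a ih x0 xa) lerDl; apply: Rintegral_ge0 => y /=.
  rewrite in_itv/= => /andP[xy ya]; rewrite mulr_ge0 ?subr_ge0 ?h0//.
  exact: le_trans x0 (ltW xy).
rewrite (Rintegral_moment_split a ih a0 ax) gerDl -oppr_ge0.
have -> : forall r : R, - r = (-1) * r by move=> r; ring.
rewrite -RintegralZl//; last first.
  apply: integrableS (moment_integrable a ih x0) => //.
  move=> y /=; rewrite !in_itv/= => /andP[ay ->].
  by rewrite (le_trans a0 (ltW ay)).
apply: Rintegral_ge0 => y /=; rewrite in_itv/= => /andP[ay yx].
rewrite mulrA mulr_ge0 ?h0//; first by rewrite mulN1r opprB subr_ge0 ltW.
exact: le_trans a0 (ltW ay).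
Qed.

Lemma optimality_equation_unique (R : realType) (mu : R) (h : R -> R)
    (xe x z : R) : 0 < mu -> is_intensity h -> 0 <= x -> 0 <= z ->
  optimality_equation mu h xe x -> optimality_equation mu h xe z -> x = z.
Proof.
move=> mu0 ih; wlog xz : x z / x <= z => [H x0 z0 ex ez|].
  by have [xz|/ltW zx] := leP x z; [exact: H|exact/esym/H].
move=> x0 z0 ex; rewrite /optimality_equation (Rintegral_moment_split z ih x0 xz).
rewrite (Rintegral_moment z x ih x0) mulrDr mulrDr {1}ex => ez.
apply/le_anti; rewrite xz/=.
have [_ h0 _] := ih.
have J0 : 0 <= mu^-1 *
    \int[lebesgue_measure]_(y in `]x, z]) ((z - y) * h y).
  rewrite mulr_ge0 ?invr_ge0 ?(ltW mu0)//; apply: Rintegral_ge0 => y /=.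
  rewrite in_itv/= => /andP[xy yz].
  by rewrite mulr_ge0 ?subr_ge0 ?h0// (le_trans x0 (ltW xy)).
have A0 : 0 <= mu^-1 * ((z - x) * arrival_rate h x).
  rewrite mulr_ge0 ?invr_ge0 ?(ltW mu0)// mulr_ge0 ?subr_ge0//.
  exact: arrival_rate_ge0.
move: ez A0 J0; move: (mu^-1 * _) (mu^-1 * _) (mu^-1 * _) => p q r.
by clear; move=> ez A0 J0; lra.
Qed.

Lemma optimality_equation_exists (R : realType) (mu : R) (h : R -> R)
    (xe : R) : 0 < mu -> is_intensity h -> 0 <= xe ->
  exists x, 0 <= x /\ optimality_equation mu h xe x.
Proof.
move=> mu0 ih xe0; have [_ h0 _] := ih.
pose F x : R := mu^-1 * (x * arrival_rate h x +
  \int[lebesgue_measure]_(y in `[0, x]) ((0 - y) * h y)) + x.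
have FE x : 0 <= x ->
    F x = mu^-1 * (\int[lebesgue_measure]_(y in `[0, x]) ((x - y) * h y)) + x.
  by move=> x0; rewrite /F (Rintegral_moment x 0 ih x0) subr0.
have Fc : {within `[0, xe], continuous F}.
  have idc : {within `[0, xe], continuous (id : R -> R)}.
    by apply: continuous_subspaceT => y; exact: cvg_id.
  have Ac : {within `[0, xe], continuous (arrival_rate h)}.
    by apply: parameterized_integral_continuous => //; exact: intensity_integrable.
  have Bc := parameterized_integral_continuous xe0 (moment_integrable 0 ih xe0).
  move=> x; apply: cvgD (idc x); apply: cvgM; first exact: cvg_cst.
  by apply: cvgD (Bc x); exact: cvgM (idc x) (Ac x).
have F0 : F 0 = 0.
  by rewrite FE// set_itv1 Rintegral_set1 mulr0 addr0.
have Fxe : xe <= F xe.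
  rewrite FE// lerDr mulr_ge0 ?invr_ge0 ?(ltW mu0)//; apply: Rintegral_ge0 => y /=.
  by rewrite in_itv/= => /andP[y0 yx]; rewrite mulr_ge0 ?subr_ge0 ?h0.
have [|x] := @IVT R F 0 xe xe xe0 Fc.
  rewrite F0 ge_min xe0/= le_max Fxe orbT//.
rewrite in_itv/= => /andP[x0 _] Fx; exists x; split => //.
by rewrite /optimality_equation -FE.
Qed.

Lemma optimal_thresholdP (R : realType) (mu : R) (h : R -> R) (xe : R) :
  0 < mu -> is_intensity h -> 0 <= xe ->
  0 <= optimal_threshold mu h xe /\
  optimality_equation mu h xe (optimal_threshold mu h xe).
Proof.
by move=> mu0 ih xe0; exact: getPex (optimality_equation_exists mu0 ih xe0).
Qed.

Lemma optimal_threshold_unique (R : realType) (mu : R) (h : R -> R)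
    (xe x : R) : 0 < mu -> is_intensity h -> 0 <= xe -> 0 <= x ->
  optimality_equation mu h xe x -> optimal_threshold mu h xe = x.
Proof.
move=> mu0 ih xe0 x0; have [s0 es] := optimal_thresholdP mu0 ih xe0.
exact: optimality_equation_unique es.
Qed.

Lemma optimal_threshold_max (R : realType) (mu ct : R) (h : R -> R)
    (xe x : R) : 0 < mu -> 0 < ct -> is_intensity h -> 0 <= xe -> 0 <= x ->
  social_benefit mu ct h xe x <=
  social_benefit mu ct h xe (optimal_threshold mu h xe).
Proof.
move=> mu0 ct0 ih xe0 x0; have [] := optimal_thresholdP mu0 ih xe0.
rewrite /optimality_equation; move: (optimal_threshold _ _ _) => s s0 es.
rewrite /social_benefit.
rewrite (Rintegral_moment xe s ih x0) (Rintegral_moment xe s ih s0).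
have := Rintegral_moment_max ih s0 x0.
have := arrival_rate_ge0 x ih; have := arrival_rate_ge0 s ih.
move: es; move: (Rintegral _ _ _) (Rintegral _ _ _) => Ix Is.
move: (arrival_rate h s) (arrival_rate h x) => Ls Lx es Ls0 Lx0 IxIs.
have IsE : Is = mu * (xe - s).
  by rewrite es addrK mulrA mulfV ?mul1r// lt0r_neq0.
have D (L : R) : 0 <= L -> 0 < 1 + mu^-1 * L.
  by move=> L0; rewrite ltr_pwDl// mulr_ge0 ?invr_ge0 ?(ltW mu0).
have mus : mu * mu^-1 = 1 by rewrite mulfV ?lt0r_neq0.
have -> : ct * ((xe - s) * Ls + Is) / (1 + mu^-1 * Ls) = ct * (mu * (xe - s)).
  apply: (canLR (mulfK (lt0r_neq0 (D _ Ls0)))); rewrite IsE.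
  transitivity (ct * (mu * (xe - s) + mu * mu^-1 * ((xe - s) * Ls))); last by ring.
  by rewrite mus mul1r addrC.
rewrite ler_pdivrMr ?D// -!mulrA ler_pM2l//.
have -> : mu * ((xe - s) * (1 + mu^-1 * Lx)) = (xe - s) * Lx + Is.
  rewrite IsE; transitivity (mu * (xe - s) + (mu * mu^-1) * ((xe - s) * Lx)).
    by ring.
  by rewrite mus mul1r addrC.
by rewrite lerD2l.
Qed.

(* Main.v *)
(* Since h -> c, the mean of |h - c| over [0, x] tends to 0. Writing
   L(x) for the integral of h and M(x) for that of (x - y) h(y) over [0, x],
   this gives L(x) ~ c x and M(x) ~ c x^2 / 2. The equation of the optimal
   threshold s reads M(s) = mu (xe - s), so s = O(sqrt xe) is negligible with
   respect to xe; it also simplifies the price of anarchy to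
   (xe - s) (mu + L(xe)) / M(xe) ~ xe (c xe) / (c xe^2 / 2) = 2. *)
Require Import Defs.
From mathcomp Require Import all_boot all_order all_algebra.
From mathcomp Require Import all_classical all_reals all_analysis.
From mathcomp Require Import ring lra.
Import Order.TTheory GRing.Theory Num.Theory.
Import numFieldNormedType.Exports.
Local Open Scope classical_set_scope.
Local Open Scope ring_scope.

(** * Limits at infinity and elementary integrals *)

Lemma cvg_dist_le (R : realFieldType) (T : Type) (F : set_system T)
    (FF : Filter F) (f g : T -> R) (l : R) :
  (\forall x \near F, `|l - f x| <= g x) -> g x @[x --> F] --> 0 ->
  f x @[x --> F] --> l.
Proof.
move=> fg /cvgr0Pnorm_le g0; apply/cvgrPdist_le => e e0.
near=> x; apply: le_trans (_ : g x <= e); first by near: x.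
by apply: le_trans (ler_norm _) _; near: x; exact: g0.
Unshelve. all: by end_near. Qed.

Lemma cvg_inv_pinfty (R : realType) : (x^-1 : R) @[x --> +oo] --> (0 : R).
Proof.
apply/(gtr0_cvgV0 (f := id)); last exact: cvg_id.
exact: nbhs_pinfty_gt.
Qed.

Lemma Rintegral_cst_itv (R : realType) (r a b : R) (p q : bool) : a <= b ->
  \int[lebesgue_measure]_(y in [set` Interval (BSide p a) (BSide q b)]) r =
  r * (b - a).
Proof.
move=> ab; rewrite Rintegral_cst//= lebesgue_measure_itv/= lte_fin.
by case: ltgtP ab => // -> _; rewrite subrr.
Qed.

(** Cesàro argument: past some [X] the integrand is at most [e / 2], and the integral over [[0, X]]
    is a constant [K], which division by a large [x] makes negligible. *)
Lemma cvg_mean_norm0 (R : realType) (f : R -> R) :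
  (forall x : R, 0 <= x -> lebesgue_measure.-integrable `[0, x] (EFin \o f)) ->
  f x @[x --> +oo] --> (0 : R) ->
  x^-1 * \int[lebesgue_measure]_(y in `[0, x]) `|f y| @[x --> +oo] --> (0 : R).
Proof.
move=> fint /cvgr0Pnorm_le f0; apply/cvgr0Pnorm_le => e e0.
have e20 : 0 < e / 2 by rewrite divr_gt0.
have [X0 [_ hX0]] := f0 _ e20.
(* The maximum with 0 puts the cut inside [[0, x]] once [x] is large. *)
pose X := Num.max 0 X0.
have X_ge0 : 0 <= X by rewrite le_max lexx.
have hX y : X < y -> `|f y| <= e / 2.
  by rewrite gt_max => /andP[_ /hX0].
pose K := \int[lebesgue_measure]_(y in `[0, X]) `|f y|.
near=> x.
have x0 : 0 < x by near: x; exact: nbhs_pinfty_gt.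
have Xx : X <= x by near: x; apply: nbhs_pinfty_ge; exact: num_real.
have Kx : K <= e / 2 * x.
  by rewrite -ler_pdivrMl//; near: x; apply: nbhs_pinfty_ge; exact: num_real.
rewrite ger0_norm ?mulr_ge0 ?invr_ge0 ?(ltW x0) ?Rintegral_ge0//.
rewrite mulrC ler_pdivrMr//.
have split : \int[lebesgue_measure]_(y in `[0, x]) `|f y| =
   K + \int[lebesgue_measure]_(y in `]X, x]) `|f y|.
  have := @Rintegral_itvB _ (fun y => `|f y|) (BLeft 0) (BRight x) X.
  rewrite /K => <-; rewrite ?bnd_simp ?subrKC//.
  exact: integrable_norm (fint _ (ltW x0)).
have sub : `]X, x] `<=` `[0, x].
  move=> y /=; rewrite !in_itv/= => /andP[Xy ->].
  by rewrite (le_trans X_ge0 (ltW Xy)).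
have tail : \int[lebesgue_measure]_(y in `]X, x]) `|f y| <= e / 2 * (x - X).
  have -> : e / 2 * (x - X) = \int[lebesgue_measure]_(y in `]X, x]) (e / 2).
    by rewrite Rintegral_cst_itv.
  apply: le_Rintegral => //.
  - by apply: integrableS (integrable_norm (fint _ (ltW x0))).
  - have : lebesgue_measure.-integrable (`[X, x] : set R) (EFin \o cst (e / 2)).
      apply: continuous_compact_integrable; first exact: segment_compact.
      by apply: continuous_subspaceT => y; exact: cvg_cst.
    apply: integrableS => //.
    by move=> y /=; rewrite !in_itv/= => /andP[/ltW -> ->].
  - by move=> y /=; rewrite in_itv/= => /andP[/hX].
have eX : 0 <= e / 2 * X by rewrite mulr_ge0 // ltW.
rewrite split; move: tail Kx eX.
by rewrite mulrBr; lra.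
Unshelve. all: by end_near. Qed.

Lemma Rintegral_subr_itv (R : realType) (x : R) : 0 < x ->
  \int[lebesgue_measure]_(y in `[0, x]) (x - y) = x ^+ 2 / 2.
Proof.
move=> x0.
pose F := fun y : R => x * y - y ^+ 2 / 2.
have dF (y : R) : is_derive y 1 F (x - y).
  apply: is_derive_eq.
  by rewrite !scaler0 /GRing.scale/=; field.
have cF : continuous F.
  by move=> y; apply: differentiable_continuous; apply/derivable1_diffP.
rewrite /Rintegral (@continuous_FTC2 _ (fun y => x - y) F)//=.
- by rewrite /F; field.
- apply: continuous_subspaceT => y.
  by apply: cvgB; [exact: cvg_cst|exact: cvg_id].
- split => [y _| |]; first by [].
  + exact: cvg_at_right_filter (cF _).
  + exact: cvg_at_left_filter (cF _).
- by move=> y _; rewrite derive1E; apply: derive_val.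
Qed.

(** Lets the integrability lemmas for intensities apply to the limit [c] as well as to [h]. *)
Lemma is_intensity_cst (R : realType) (c : R) : 0 <= c -> is_intensity (cst c).
Proof.
move=> c0; split => // x x0.
rewrite /= integral_cst//= lebesgue_measure_itv/= lte_fin.
by case: ifP => _; rewrite ?mule0 ?ltry// -EFinB -EFinM ltry.
Qed.

(** * Asymptotics of the arrival rate, the moment and the optimal threshold *)

Section intensity_asymptotics.
Context (R : realType) (h : R -> R) (c : R).
Hypotheses (ih : is_intensity h) (c_gt0 : 0 < c) (hc : h x @[x --> +oo] --> c).

Let ic : is_intensity (cst c). Proof. exact/is_intensity_cst/ltW. Qed.

Let itv_measurable (x : R) : measurable (`[0, x] : set (measurableTypeR R)).
Proof. exact: measurable_itv. Qed.

Let deviation_integrable (x : R) : 0 <= x ->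
  lebesgue_measure.-integrable `[0, x] (EFin \o (fun y => h y - c)).
Proof.
move=> x0; exact: (integrableB (itv_measurable x) (intensity_integrable ih x0)
  (intensity_integrable ic x0)).
Qed.

(** A common error bound: it dominates the distance of L(x) / x to [c] and that of M(x) / x^2 to
    [c / 2]. *)
Let mean_deviation (x : R) : R :=
  x^-1 * \int[lebesgue_measure]_(y in `[0, x]) `|h y - c|.

Let mean_deviation_cvg0 : mean_deviation x @[x --> +oo] --> (0 : R).
Proof.
apply: (@cvg_mean_norm0 R (fun y => h y - c)) => //.
by rewrite -(subrr c); apply: cvgB hc _; exact: cvg_cst.
Qed.

Lemma mean_arrival_rate_cvg : x^-1 * arrival_rate h x @[x --> +oo] --> c.
Proof.
apply: cvg_dist_le mean_deviation_cvg0; near=> x.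
have x0 : 0 < x by near: x; exact: nbhs_pinfty_gt.
have -> : c - x^-1 * arrival_rate h x =
    - (x^-1 * \int[lebesgue_measure]_(y in `[0, x]) (h y - c)).
  rewrite RintegralB//; last 2 first.
  - exact: intensity_integrable ih (ltW x0).
  - exact: intensity_integrable ic (ltW x0).
  rewrite Rintegral_cst_itv ?ltW// subr0 /arrival_rate.
  by field; rewrite gt_eqF.
rewrite normrN normrM gtr0_norm ?invr_gt0// ler_pM2l ?invr_gt0//.
exact: le_normr_Rintegral (deviation_integrable x (ltW x0)).
Unshelve. all: by end_near. Qed.

(** The constant intensity [c] has moment c x^2 / 2, and the weight [x - y] is at most [x] on
    [[0, x]], so the error is at most [x^-2 * x] times the integral of |h - c|. *)
Lemma mean_moment_cvg :
  x^-2 * \int[lebesgue_measure]_(y in `[0, x]) ((x - y) * h y)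
    @[x --> +oo] --> c / 2.
Proof.
apply: cvg_dist_le mean_deviation_cvg0; near=> x.
have x0 : 0 < x by near: x; exact: nbhs_pinfty_gt.
have ihx := moment_integrable x ih (ltW x0).
have icx := moment_integrable x ic (ltW x0).
have idev : lebesgue_measure.-integrable `[0, x]
    (EFin \o (fun y => (x - y) * (h y - c))).
  apply: eq_integrable (integrableB (itv_measurable x) ihx icx) => //.
  by move=> y _ /=; rewrite -EFinB mulrBr.
have -> : c / 2 - x^-2 * \int[lebesgue_measure]_(y in `[0, x]) ((x - y) * h y)
   = - (x^-2 * \int[lebesgue_measure]_(y in `[0, x]) ((x - y) * (h y - c))).
  have -> : \int[lebesgue_measure]_(y in `[0, x]) ((x - y) * (h y - c)) =
      \int[lebesgue_measure]_(y in `[0, x]) ((x - y) * h y - (x - y) * c).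
    by apply: eq_Rintegral => y _; rewrite mulrBr.
  rewrite RintegralB// RintegralZr//; last first.
    (* The weight [x - y] is integrable as the moment integrand of the intensity 1. *)
    have i1 := moment_integrable x (is_intensity_cst R 1 ler01) (ltW x0).
    by apply: eq_integrable i1 => // y _ /=; rewrite mulr1.
  rewrite Rintegral_subr_itv//.
  by field; rewrite gt_eqF.
rewrite normrN normrM gtr0_norm ?invr_gt0 ?exprn_gt0//.
have -> : mean_deviation x =
    x^-2 * (x * \int[lebesgue_measure]_(y in `[0, x]) `|h y - c|).
  by rewrite /mean_deviation; field; rewrite gt_eqF.
rewrite ler_pM2l ?invr_gt0 ?exprn_gt0//.
apply: le_trans (le_normr_Rintegral (itv_measurable x) idev) _.
rewrite -RintegralZl//; last first.
  exact: integrable_norm (deviation_integrable x (ltW x0)).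
apply: le_Rintegral => //.
- exact: integrable_norm.
- exact: (integrableZl (itv_measurable x) x
    (integrable_norm (deviation_integrable x (ltW x0)))).
- move=> y /=; rewrite in_itv/= => /andP[y0 yx].
  by rewrite normrM ler_wpM2r// ger0_norm ?subr_ge0// gerBl.
Unshelve. all: by end_near. Qed.

(** By contradiction: if [s] exceeded [xe * e], M(s) would grow at least like [xe ^+ 2], whereas the
    optimality equation bounds it by [mu * xe]. *)
Lemma optimal_threshold_negligible (mu : R) : 0 < mu ->
  xe^-1 * optimal_threshold mu h xe @[xe --> +oo] --> (0 : R).
Proof.
move=> mu0; apply/cvgr0Pnorm_le => e e0.
(* Half of the limit [c / 2], so that M(s) / s^2 stays above [c / 4] for [s] past [X0]. *)
have c40 : 0 < c / 4 by rewrite divr_gt0.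
have [X0 [_ hX0]] := cvgr_dist_le _ _ mean_moment_cvg _ c40.
near=> xe.
have xe0 : 0 < xe by near: xe; exact: nbhs_pinfty_gt.
have [s0] := optimal_thresholdP mu0 ih (ltW xe0).
rewrite /optimality_equation; set s := optimal_threshold mu h xe in s0 *.
set M := Rintegral _ _ _ => es.
rewrite ger0_norm ?mulr_ge0 ?invr_ge0 ?(ltW xe0)// ler_pdivrMl//.
rewrite leNgt; apply/negP => es_lt.
have X0s : X0 < s.
  apply: lt_trans es_lt; rewrite -ltr_pdivrMr//.
  by near: xe; apply: nbhs_pinfty_gt; exact: num_real.
have s_gt0 : 0 < s by apply: lt_trans es_lt; rewrite mulr_gt0.
have /= /ler_normlP[_ hM] := hX0 _ X0s; rewrite -/M in hM.
have lowM : c / 4 * s ^+ 2 <= M.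
  rewrite -ler_pdivlMr ?exprn_gt0// [leRHS]mulrC.
  by move: hM; lra.
have upM : M <= mu * xe.
  by rewrite mulrC -ler_pdivrMr// mulrC es lerDl.
(* Multiplied by [xe], this sets the quadratic lower bound on [M] against [upM]. *)
have big : mu < c / 4 * e ^+ 2 * xe.
  rewrite mulrC -ltr_pdivrMr ?mulr_gt0 ?exprn_gt0//.
  by near: xe; apply: nbhs_pinfty_gt; exact: num_real.
have : mu * xe < mu * xe.
  apply: lt_le_trans (_ : c / 4 * (xe * e) ^+ 2 <= _).
    have -> : c / 4 * (xe * e) ^+ 2 = c / 4 * e ^+ 2 * xe * xe by ring.
    by rewrite ltr_pM2r.
  apply: le_trans upM; apply: le_trans lowM.
  by rewrite ler_pM2l// lerXn2r ?nnegrE// ?mulr_ge0 ?ltW.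
by rewrite ltxx.
Unshelve. all: by end_near. Qed.

End intensity_asymptotics.

(** * The limit of the price of anarchy *)

Theorem proposition3p12 (R : realType) (mu ct : R) (h : R -> R) (c : R)
  (mu_gt0 : 0 < mu) (ct_gt0 : 0 < ct) (h_intensity : is_intensity h)
  (c_gt0 : 0 < c) (h_lim : h x @[x --> +oo] --> c) :
  PoA mu ct h xe @[xe --> +oo] --> (2 : R).
Proof.
have threshold_cvg :=
  optimal_threshold_negligible R h c h_intensity c_gt0 h_lim mu mu_gt0.
have L_cvg := mean_arrival_rate_cvg R h c h_intensity c_gt0 h_lim.
have M_cvg := mean_moment_cvg R h c h_intensity c_gt0 h_lim.
have -> : (2 : R) = (1 - 0) * (mu * 0 + c) / (c / 2) by field; rewrite gt_eqF.
(* This is (x - s) (mu + L(x)) / M(x), with numerator and denominator divided by x^2 so that each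
   factor converges. *)
pose f (x : R) := (1 - x^-1 * optimal_threshold mu h x) *
  (mu * x^-1 + x^-1 * arrival_rate h x) /
  (x^-2 * \int[lebesgue_measure]_(y in `[0, x]) ((x - y) * h y)).
apply: (@cvg_trans _ (f @ +oo)); last first.
  apply: cvgM; last by apply: cvgV; [rewrite gt_eqF ?divr_gt0|exact: M_cvg].
  apply: cvgM; first by apply: cvgB threshold_cvg; exact: cvg_cst.
  apply: cvgD L_cvg; apply: cvgM; first exact: cvg_cst.
  exact: cvg_inv_pinfty.
apply: near_eq_cvg; near=> x.
have x0 : 0 < x by near: x; exact: nbhs_pinfty_gt.
(* The limit [c / 2] is positive, so the denominator of the price of anarchy is eventually nonzero
   and the convention for division by 0 does not interfere. *)
have M_gt0 : 0 < x^-2 * \int[lebesgue_measure]_(y in `[0, x]) ((x - y) * h y).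
  by near: x; apply: (cvgr_gt _ M_cvg); rewrite divr_gt0.
rewrite /f PoAE//= -/(arrival_rate h x).
have [s0] := optimal_thresholdP mu_gt0 h_intensity (ltW x0).
rewrite /optimality_equation; set s := optimal_threshold mu h x in s0 *.
rewrite -/(arrival_rate h s) => es.
have Ls0 := arrival_rate_ge0 s h_intensity.
rewrite (Rintegral_moment x s h_intensity s0).
move: es; set Ms := Rintegral _ _ _ => es.
(* The numerator becomes (x - s) (L(s) + mu), and its second factor cancels against 1 + L(s) /
   mu. *)
have -> : Ms = mu * (x - s).
  by rewrite {1}es addrK mulrA divff ?mul1r// gt_eqF.
set M := Rintegral _ _ _ in M_gt0 *.
have M0 : M != 0.
  by apply: contraTneq M_gt0 => ->; rewrite mulr0 ltxx.
field; rewrite M0 !gt_eqF//= ltr_wpDr.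
Unshelve. all: by end_near. Qed.
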